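(* Assume Martin's axiom and the negation of the continuum hypothesis (MA+$\neg$CH). Suppose that $X$ is a Banach space of density $\omega_1$ whose dual unit ball $B_{X^*}$ is not monolithic in the weak$^*$ topology. Then $X$ does not admit an overcomplete set.
   Context: All Banach spaces are infinite dimensional and over the reals. $dens(X)$ (the density) is the minimal cardinality of a norm dense subset of $X$. A subset $Y$ of a Banach space $X$ is called overcomplete (in $X$) if $|Y|=dens(X)$ and every $Z\subseteq Y$ with $|Z|=|Y|$ is linearly dense in $X$ (its linear span is norm dense in $X$). A topological space is called monolithic if the closures of its countable subsets are metrizable. MA: for every partial order with the countable chain condition and every family of fewer than $\mathfrak{c}$ dense subsets there is a filter meeting all of them ($\mathfrak{c}=|\mathbb{R}|$). *)

(* Defs.v *)
From HB Require Import structures.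
From mathcomp Require Import all_boot all_order all_algebra.
From mathcomp Require Import all_classical all_reals all_analysis.
Import Order.TTheory GRing.Theory Num.Theory.
Import numFieldNormedType.Exports.

Set Implicit Arguments.
Unset Strict Implicit.
Unset Printing Implicit Defensive.

Local Open Scope classical_set_scope.
Local Open Scope card_scope.
Local Open Scope ring_scope.

Definition card_lt (T U : Type) (A : set T) (B : set U) : Prop :=
  A #<= B /\ A #!= B.

(* There is no type of cardinals here: [card_omega1 A] says |A| = omega_1,
   omega_1 being the least uncountable cardinal. *)
Definition card_omega1 (T : Type) (A : set T) : Prop :=
  ~ countable A /\
  forall (U : Type) (B : set U), ~ countable B -> A #<= B.

Definition continuum_hypothesis (R : realType) : Prop :=
  card_omega1 [set: R].

Section forcing.
Context (d : Order.disp_t) (P : porderType d).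

Definition compatible (p q : P) : Prop :=
  exists r : P, (r <= p)%O /\ (r <= q)%O.

(* Antichains in the forcing sense: distinct elements have no common lower
   bound (which is stronger than being incomparable). *)
Definition antichain (A : set P) : Prop :=
  forall p q, A p -> A q -> compatible p q -> p = q.

Definition ccc : Prop := forall A : set P, antichain A -> countable A.

Definition forcing_dense (D : set P) : Prop :=
  forall p : P, exists2 q : P, D q & (q <= p)%O.

Definition forcing_filter (G : set P) : Prop :=
  [/\ G !=set0,
      forall p q : P, G p -> (p <= q)%O -> G q &
      forall p q : P, G p -> G q ->
        exists2 r : P, G r & (r <= p)%O /\ (r <= q)%O].

End forcing.
Arguments ccc {d} P.

(* Partial orders are nonempty in forcing; filters being nonempty, the axiom
   would be false for the empty order. *)
Definition martin_axiom (R : realType) : Prop :=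
  forall (d : Order.disp_t) (P : porderType d),
    [set: P] !=set0 -> ccc P ->
    forall F : set (set P),
      card_lt F [set: R] -> (forall D, F D -> forcing_dense D) ->
      exists2 G : set P, forcing_filter G &
        forall D, F D -> (D `&` G) !=set0.

Definition metrizable (R : realType) (T : topologicalType) : Prop :=
  exists dist : T -> T -> R,
    [/\ forall x y, dist x y = 0 <-> x = y,
        forall x y, dist x y = dist y x,
        forall x y z, dist x z <= dist x y + dist y z &
        forall (x : T) (U : set T),
          nbhs x U <-> exists2 e : R, 0 < e & [set y | dist x y < e] `<=` U].

(* [set_type A] carries the subspace topology. *)
Definition monolithic (R : realType) (T : topologicalType) : Prop :=
  forall A : set T, countable A -> metrizable R (set_type (closure A)).

Section banach.
Context (R : realType) (X : normedModType R).

Definition lin_span (Z : set X) : set X :=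
  [set x | exists (n : nat) (a : 'I_n -> R) (z : 'I_n -> X),
     (forall i, Z (z i)) /\ x = \sum_(i < n) a i *: z i].

Definition infinite_dimensional : Prop :=
  ~ exists2 F : set X, finite_set F & lin_span F = setT.

(* |A| = dens(X): A is equipotent to a dense subset of minimal cardinality. *)
Definition card_dens (U : Type) (A : set U) : Prop :=
  exists D : set X,
    [/\ dense D, forall E : set X, dense E -> D #<= E & A #= D].

Definition overcomplete (Y : set X) : Prop :=
  card_dens Y /\
  forall Z : set X, Z `<=` Y -> Z #= Y -> dense (lin_span Z).

Definition dual_norm (f : X -> R^o) : R :=
  sup [set `|f x| | x in [set x : X | `|x| <= 1]].

(* The ambient [{ptws X -> R^o}] (pointwise convergence) induces the weak*
   topology. Continuity ensures that the supremum in [dual_norm] is finite. *)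
Definition dual_unit_ball : set {ptws X -> R^o} :=
  [set f | [/\ linear (f : X -> R^o), continuous (f : X -> R^o) &
               dual_norm f <= 1]].

End banach.
Arguments infinite_dimensional {R} X.
Arguments card_dens {R} X {U} A.
Arguments dual_unit_ball {R} X.

(* Main.v *)
Require Import Defs.
From HB Require Import structures.
From mathcomp Require Import all_boot all_order all_algebra.
From mathcomp Require Import finmap ring lra.
From mathcomp Require Import all_classical all_reals all_analysis.
Import Order.TTheory GRing.Theory Num.Theory.
Import numFieldNormedType.Exports.

Set Implicit Arguments.
Unset Strict Implicit.
Unset Printing Implicit Defensive.

Local Open Scope classical_set_scope.
Local Open Scope card_scope.
Local Open Scope ring_scope.

(* Let A be a countable subset of the dual ball whose weak* closure is not
   metrizable, g an enumeration of A, and L the linear span of A, which is norm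
   separable. An overcomplete set Y contains an uncountable set W whose finite
   subsets can be ordered so that each element is separated from the preceding
   ones by functionals of L of uniformly bounded norm; otherwise countably many
   evaluations would determine the topology of the closure of A. Hence
   prescribed values on a k-element subset of W are attained by some element of
   L whose norm is controlled by the values and k alone.
   Force with triples (phi, F, r), where phi in L vanishes on the finite set
   F in W and r is the distance by which phi may still be moved. Moving phi by
   interpolation on a union of two sets F shows that conditions with |F| and r
   controlled and with phi nearby are compatible, so separability of L gives the
   countable chain condition. A filter meeting omega_1 < c dense sets yields a
   nonzero functional that vanishes on an uncountable subset of Y, which thus
   does not span a dense subspace. *)

(** * Bounded functionals and finite combinations of a sequence [g] *)

Section Functionals.
Context (R : realType) (X : normedModType R).

Definition bounded_by (phi : X -> R) (m : R) : Prop :=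
  forall x, `|phi x| <= m * `|x|.

Lemma bounded_by_le (phi : X -> R) (m m' : R) :
  m <= m' -> bounded_by phi m -> bounded_by phi m'.
Proof.
by move=> mm' pm x; apply: le_trans (pm x) _; exact: ler_wpM2r.
Qed.

Lemma bounded_byD (phi psi : X -> R) (m m' c : R) :
  bounded_by phi m -> bounded_by psi m' ->
  bounded_by (fun x => phi x + c * psi x) (m + `|c| * m').
Proof.
move=> pm pm' x; rewrite mulrDl; apply: le_trans (ler_normD _ _) _.
by apply: lerD => //; rewrite normrM -mulrA; exact: ler_wpM2l.
Qed.

(** Indices may repeat in the list, so that sums are concatenations. *)
Definition combination (g : nat -> X -> R) (l : seq (nat * R)) (x : X) : R :=
  \sum_(p <- l) p.2 * g p.1 x.

Definition is_linear (phi : X -> R) : Prop :=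
  forall (a : R) x y, phi (a *: x + y) = a * phi x + phi y.

Section Combinations.
Context (g : nat -> X -> R).
Definition combinations : set (X -> R) := range (combination g).

Lemma combination_cons n c l x :
  combination g ((n, c) :: l) x = c * g n x + combination g l x.
Proof. by rewrite /combination big_cons. Qed.

Lemma combinations0 : combinations (fun=> 0).
Proof.
by exists [::] => //; apply/funext => x; rewrite /combination big_nil.
Qed.

Lemma combinationsD phi psi c : combinations phi -> combinations psi ->
  combinations (fun x => phi x + c * psi x).
Proof.
move=> [l _ <-] [l' _ <-]; exists (l ++ [seq (p.1, c * p.2) | p <- l']) => //.
apply/funext => x; rewrite /combination big_cat big_map; congr (_ + _).
by rewrite big_distrr; apply: eq_bigr => p _; rewrite /= mulrA.
Qed.

Lemma combinationsZ phi c : combinations phi ->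
  combinations (fun x => c * phi x).
Proof.
move=> pA; have := combinationsD c combinations0 pA.
by congr combinations; apply/funext => x; rewrite add0r.
Qed.

Lemma combinations_gen n : combinations (g n).
Proof.
exists [:: (n, 1)] => //; apply/funext => x.
by rewrite /combination big_seq1 mul1r.
Qed.

Hypothesis g_linear : forall n, is_linear (g n).
Hypothesis g_bounded : forall n, bounded_by (g n) 1.

Lemma combinations_linear phi : combinations phi -> is_linear phi.
Proof.
move=> [l _ <-] a x y; rewrite /combination big_distrr -big_split/=.
by apply: eq_bigr => p _; rewrite g_linear mulrDr mulrCA.
Qed.

Lemma combinations_bounded phi : combinations phi ->
  exists2 m, 0 <= m & bounded_by phi m.
Proof.
move=> [l _ <-]; elim: l => [|[n c] l [m m0 lm]].
  by exists 0 => // x; rewrite /combination big_nil normr0 mul0r.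
exists (m + `|c| * 1); first by rewrite addr_ge0 ?mulr1.
move=> x; rewrite combination_cons addrC.
exact: (bounded_byD c lm (g_bounded n)).
Qed.

Lemma combinations_separable phi (d : R) : combinations phi -> 0 < d ->
  exists l : seq (nat * rat), bounded_by
    (fun x => phi x - combination g [seq (p.1, ratr p.2) | p <- l] x) d.
Proof.
move=> [l _ <-]; elim: l d => [|[n c] l IH] d d0.
  exists [::] => x; rewrite /combination/= !big_nil subrr normr0.
  by rewrite mulr_ge0 // ltW.
have d20 : 0 < d / 2 by rewrite divr_gt0.
have [l' l'P] := IH _ d20.
have cd : c < c + d / 2 by rewrite ltrDl.
have [q] := rat_in_itvoo cd; rewrite in_itv/= => /andP[cq qd].
exists ((n, q) :: l') => x /=; rewrite !combination_cons opprD addrACA -mulrBl.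
rewrite addrC; apply: le_trans (bounded_byD _ l'P (g_bounded n) x) _.
rewrite mulr1; apply: ler_wpM2r => //.
rewrite ltr0_norm; last by rewrite subr_lt0.
lra.
Qed.

(** The bound [C] depends on the points but not on [phi]. No independence of the points is assumed,
    since the values to be attained are those of a combination. If some combination [b] vanishes at
    the earlier points and is 1 at the new one, a multiple of [b] corrects [chi]. If there is none,
    [phi - chi], which vanishes at the earlier points, must vanish at the new one too. *)
Lemma interpolation (w : nat -> X) n : exists2 C : R, 0 <= C &
  forall phi (d : R), combinations phi -> 0 <= d ->
    (forall k, (k < n)%N -> `|phi (w k)| <= d) ->
  exists chi, [/\ combinations chi,
    forall k, (k < n)%N -> chi (w k) = phi (w k) & bounded_by chi (C * d)].
Proof.
elim: n => [|n [C C0 IH]].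
  exists 0 => // phi d _ d0 _; exists (fun=> 0); split => //.
    exact: combinations0.
  by move=> x; rewrite normr0 !mul0r.
have [[b [bA b0 b1]]|nb] := pselect (exists b, [/\ combinations b,
    forall k, (k < n)%N -> b (w k) = 0 & b (w n) = 1]).
  have [B B0 bB] := combinations_bounded bA.
  exists (C + (1 + C * `|w n|) * B).
    by rewrite addr_ge0 // mulr_ge0 // addr_ge0 // mulr_ge0.
  move=> phi d pA d0 pd.
  have [k kn|chi [cA cphi cC]] := IH phi d pA d0; first exact/pd/ltnW.
  exists (fun x => chi x + (phi (w n) - chi (w n)) * b x); split.
  - exact: combinationsD.
  - move=> k; rewrite ltnS leq_eqVlt => /predU1P[->|kn].
      by rewrite b1 mulr1 addrC subrK.
    by rewrite b0 // mulr0 addr0 cphi.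
  - apply: bounded_by_le (bounded_byD _ cC bB).
    rewrite mulrDl lerD2l mulrAC; apply: ler_wpM2r => //.
    apply: le_trans (ler_normB _ _) _; rewrite mulrDl mul1r lerD ?pd //.
    by rewrite mulrAC; exact: cC.
exists C => // phi d pA d0 pd.
have [k kn|chi [cA cphi cC]] := IH phi d pA d0; first exact/pd/ltnW.
exists chi; split => // k; rewrite ltnS leq_eqVlt => /predU1P[->|]; last first.
  exact: cphi.
pose b x := phi x + (-1) * chi x.
have bA : combinations b by exact: combinationsD.
apply/eqP; rewrite -subr_eq0 -opprB oppr_eq0; apply/eqP.
have [//|/eqP bn] := eqVneq (phi (w n) - chi (w n)) 0.
case: nb; exists (fun x => (b (w n))^-1 * b x).
have bE : b (w n) = phi (w n) - chi (w n) by rewrite /b mulN1r.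
split; first exact: combinationsZ.
- by move=> k' k'n; rewrite {2}/b cphi // mulN1r subrr mulr0.
- by rewrite mulVf // bE; exact/eqP.
Qed.

End Combinations.
End Functionals.

(** The value [x0] pads the indices missed by the injection, so [A] may be finite or empty. *)
Lemma countable_range (T : Type) (x0 : T) (A : set T) : countable A ->
  exists w : nat -> T, A `<=` range w /\ forall n, w n = x0 \/ A (w n).
Proof.
move=> /countable_injP[f finj].
pose w n := if pselect (exists2 x, A x & f x = n) is left e
  then s2val (cid2 e) else x0.
exists w; split=> [x Ax|n]; last first.
  by rewrite /w; case: pselect => [e|]; [right; case: (cid2 e)|left].
exists (f x) => //; rewrite /w; case: pselect => [e|]; last by case; exists x.
by case: (cid2 e) => z Az /= fz; apply: finj; rewrite ?inE.
Qed.

(** * Uniformly separated sets *)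

Section Separated.
Context (R : realType) (X : normedModType R) (g : nat -> X -> R).

(** The head is the newest point, and its functional vanishes only on the tail: a triangular system,
    weaker than a biorthogonal one. *)
Fixpoint separated (m : R) (s : seq X) : Prop :=
  if s is y :: s' then
    [/\ `|y| <= m, separated m s' &
      exists a, [/\ combinations g a, bounded_by a m,
                    forall x, x \in s' -> a x = 0 & a y = 1]]
  else True.

Lemma separated_uniq m s : separated m s -> uniq s.
Proof.
elim: s => //= y s IH [_ /IH-> [a [_ _ a0 a1]]]; rewrite andbT.
by apply/negP => /a0/eqP; rewrite a1 oner_eq0.
Qed.

(** [C] depends on [m] and [k] alone, and this uniformity is what the chain condition will use.
    After interpolation on the tail, a multiple of the functional of the head corrects the value
    there without disturbing the tail. *)
Lemma separated_interpolation (m : R) k : 0 <= m -> exists2 C : R, 0 <= C &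
  forall s (v : X -> R) (d : R), separated m s -> (size s <= k)%N -> 0 <= d ->
    (forall x, x \in s -> `|v x| <= d) ->
  exists chi, [/\ combinations g chi,
    forall x, x \in s -> chi x = v x & bounded_by chi (C * d)].
Proof.
move=> m0; elim: k => [|k [C C0 IH]].
  exists 0 => // -[|//] v d _ _ d0 _; exists (fun=> 0); split => //.
    exact: combinations0.
  by move=> x; rewrite normr0 !mul0r.
(* The correcting coefficient [v y - chi y] is at most [(1 + C * m) * d], and [a] has bound [m]. *)
exists (C + (1 + C * m) * m).
  by rewrite addr_ge0 // mulr_ge0 // addr_ge0 // mulr_ge0.
move=> [|y s] v d.
  move=> _ _ d0 _; exists (fun=> 0); split => //; first exact: combinations0.
  move=> x; rewrite normr0 !mulr_ge0 // addr_ge0 // mulr_ge0 // addr_ge0 //.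
  exact: mulr_ge0.
move=> /= [ym sep [a [aA am a0 a1]]]; rewrite ltnS => sk d0 vd.
have [x xs|chi [cA cv cC]] := IH s v d sep sk d0.
  by apply: vd; rewrite in_cons xs orbT.
exists (fun x => chi x + (v y - chi y) * a x); split.
- exact: combinationsD.
- move=> x; rewrite in_cons => /predU1P[->|xs].
    by rewrite a1 mulr1 addrC subrK.
  by rewrite a0 // mulr0 addr0 cv.
- apply: bounded_by_le (bounded_byD _ cC am).
  rewrite mulrDl lerD2l mulrAC; apply: ler_wpM2r => //.
  apply: le_trans (ler_normB _ _) _; rewrite mulrDl mul1r lerD //.
    by apply: vd; rewrite mem_head.
  rewrite mulrAC; apply: le_trans (cC y) _; apply: ler_wpM2l => //.
  exact: mulr_ge0.
Qed.

(** Each finite subset may choose its own order, which makes this a property of finite character,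
    fit for Zorn's lemma. *)
Definition finitely_separated (m : R) (W : set X) : Prop :=
  forall F : {fset X}, (forall x, x \in F -> W x) ->
    exists2 s, separated m s & s =i F.

Lemma finitely_separated_maximal m (Y : set X) : exists W : set X,
  [/\ W `<=` Y, finitely_separated m W &
      forall y, Y y -> finitely_separated m (y |` W) -> W y].
Proof.
pose P (W : set X) := W `<=` Y /\ finitely_separated m W.
have [C CP Ctot|W [[WY Wsep] Wmax]] := @Zorn_bigcup _ P.
  split=> [x [A /CP[AY _] Ax]|F FC]; first exact: AY.
  (* The empty set is treated apart: the chain may be empty, and the induction below needs a member
     of it to start from. *)
  have [->|[x0 x0F]] := fset_0Vmem F; first by exists [::].
  suff [A CA FA] : exists2 A, C A &
      forall x, x \in enum_fset F -> A x.
    by have [_ /(_ F FA)] := CP _ CA.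
  have [A0 CA0 _] := FC _ x0F.
  have {x0F} : forall x, x \in enum_fset F -> exists2 A, C A & A x.
    by move=> x /FC[A CA Ax]; exists A.
  elim: (enum_fset F) => [|x s IH] sC; first by exists A0.
  have [|A CA sA] := IH.
    by move=> y ys; apply: sC; rewrite in_cons ys orbT.
  have [B CB Bx] := sC x (mem_head _ _).
  have [AB|BA] := Ctot _ _ CA CB.
    by exists B => // y; rewrite in_cons => /predU1P[->//|/sA/AB].
  by exists A => // y; rewrite in_cons => /predU1P[->|/sA//]; exact: BA.
exists W; split=> // y Yy sep; apply: contrapT => Wy.
apply: (Wmax (y |` W)); last by split=> // x [->//|/WY].
split=> [|/(_ y)]; first by right.
by apply: contra_not Wy; apply; left.
Qed.

Lemma finitely_separatedU1 m (W : set X) y :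
  finitely_separated m W -> `|y| <= m ->
  (forall F : {fset X}, (forall x, x \in F -> W x) ->
    exists a, [/\ combinations g a, bounded_by a m,
                  forall x, x \in F -> a x = 0 & a y = 1]) ->
  finitely_separated m (y |` W).
Proof.
move=> Wsep ym yW F FW.
have FW' x : x \in (F `\ y)%fset -> W x.
  by rewrite in_fsetD1 => /andP[/eqP xy /FW[]].
have [s ssep sF] := Wsep _ FW'.
have [yF|yF] := boolP (y \in F); last first.
  exists s => // x; rewrite sF in_fsetD1; case: eqP => // ->.
  by rewrite (negbTE yF).
exists (y :: s).
  split=> //; have [a [aA am a0 a1]] := yW _ FW'.
  by exists a; split=> // x xs; apply: a0; rewrite -sF.
by move=> x; rewrite in_cons sF in_fsetD1; case: eqP => // ->; rewrite yF.
Qed.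

(* A weak* limit point of the functionals [a] vanishes on the range of [w] and
   equals [1] at [y]; the finitary form avoids appealing to compactness. *)
Definition far_from (w : nat -> X) (y : X) : Prop :=
  exists m : R, forall n, exists a, [/\ combinations g a, bounded_by a m,
    forall k, (k < n)%N -> a (w k) = 0 & a y = 1].

(** Take a maximal separated [W m] for each natural [m]. If all were countable, some [w] would
    enumerate their union. A point [y] far from [w] could be added to [W m] for large [m], so by
    maximality it is already some [w k], where its separating functional would be both 0 and 1. *)
Lemma uncountable_finitely_separated (Y : set X) :
  (forall w, exists2 y, Y y & far_from w y) ->
  exists (m : R) (W : set X), [/\ 0 <= m, W `<=` Y, ~ countable W &
    finitely_separated m W].
Proof.
move=> Yfar; apply: contrapT => H.
have [W WP] := choice (fun m : nat => finitely_separated_maximal m%:R Y).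
have Wc m : countable (W m).
  apply: contrapT => Wm; apply: H; exists m%:R, (W m).
  by have [WY Wsep _] := WP m; split.
have [w [Ww _]] := countable_range (0 : X)
  (bigcup_countable (countableP [set: nat]) (fun m _ => Wc m)).
have [y Yy [m0 ym0]] := Yfar w.
pose m := Num.bound (Num.max `|m0| `|y|).
have mm : Num.max `|m0| `|y| <= m%:R.
  by apply/ltW/archi_boundP; rewrite le_max normr_ge0.
have ym : `|y| <= m%:R by apply: le_trans mm; rewrite le_max lexx orbT.
have m0m : m0 <= m%:R.
  by apply: le_trans (ler_norm _) (le_trans _ mm); rewrite le_max lexx.
have [WY Wsep Wmax] := WP m.
have : W m y.
  apply: Wmax => //; apply: finitely_separatedU1 => // F FW.
  suff [n nP] : exists n, forall x, x \in enum_fset F ->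
      exists2 k, (k < n)%N & w k = x.
    have [a [aA am a0 a1]] := ym0 n; exists a; split=> //.
      exact: bounded_by_le am.
    by move=> x /nP[k kn <-]; exact: a0.
  have : forall x, x \in enum_fset F -> range w x.
    by move=> x xF; apply: Ww; exists m => //; exact: FW.
  elim: (enum_fset F) => [|x s IH] sw; first by exists 0%N.
  have [|n nP] := IH.
    by move=> z zs; apply: sw; rewrite in_cons zs orbT.
  have [k _ kx] := sw x (mem_head _ _); exists (maxn n k.+1) => z.
  rewrite in_cons => /predU1P[->|/nP[j jn jz]].
    by exists k => //; rewrite leq_max ltnSn orbT.
  by exists j => //; rewrite leq_max jn.
move=> Wy; have [k _ kx] : range w y by apply: Ww; exists m.
have [a [_ _ a0 a1]] := ym0 k.+1.
by move: (a0 k (ltnSn k)); rewrite kx a1 => /eqP; rewrite oner_eq0.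
Qed.

End Separated.

(** * A metric from countably many coordinates *)

Section Metrization.
Context (R : realType) (K : topologicalType) (e : nat -> K -> R).

(** Truncating coordinate [k] at [1/(k+1)] leaves only finitely many coordinates relevant at each
    scale, so the supremum metric gives coordinatewise convergence. *)
Let gap (f g : K) (k : nat) : R := Num.min `|e k f - e k g| k.+1%:R^-1.
Let gap_dist (f g : K) : R := sup (range (gap f g)).

Let gap_le f g k : gap f g k <= gap_dist f g.
Proof.
apply: sup_upper_bound; last by exists k.
split; first by exists (gap f g 0%N); exists 0%N.
exists 1 => _ [j _ <-]; rewrite ge_min; apply/orP; right.
by rewrite invf_le1 // ler1n.
Qed.

Let gap_dist_le f g c : (forall k, gap f g k <= c) -> gap_dist f g <= c.
Proof.
move=> gc; apply: ge_sup; first by exists (gap f g 0%N); exists 0%N.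
by move=> _ [k _ <-].
Qed.

Let gap_ge0 f g k : 0 <= gap f g k.
Proof. by rewrite le_min normr_ge0 invr_ge0 ler0n. Qed.

Lemma metrizable_countable_separation :
  (forall k, continuous (e k)) ->
  (forall f g, (forall k, e k f = e k g) -> f = g) ->
  (forall f U, nbhs f U -> exists n, forall g,
    (forall k, (k < n)%N -> `|e k f - e k g| < n.+1%:R^-1) -> U g) ->
  metrizable R K.
Proof.
move=> e_cont e_inj e_nbhs.
exists gap_dist; split.
- move=> f g; split=> [fg0|->]; last first.
    apply/eqP; rewrite eq_le (le_trans (gap_ge0 g g 0%N) (gap_le _ _ _)) andbT.
    by apply: gap_dist_le => k; rewrite /gap subrr normr0 ge_min lexx.
  apply: e_inj => k; have := gap_le f g k; rewrite fg0 ge_min.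
  by rewrite normr_le0 subr_eq0 leNgt invr_gt0 ltr0Sn orbF => /eqP.
- move=> f g; rewrite /gap_dist (_ : gap f g = gap g f) //.
  by apply/funext => k; rewrite /gap distrC.
- move=> f g h; apply: gap_dist_le => k.
  apply: le_trans (lerD (gap_le f g k) (gap_le g h k)).
  rewrite /gap; have := ler_distD (e k g) (e k f) (e k h).
  have : 0 <= (k.+1%:R^-1 : R) by rewrite invr_ge0 ler0n.
  have := normr_ge0 (e k f - e k g); have := normr_ge0 (e k g - e k h).
  move: `|e k f - e k h| `|e k f - e k g| `|e k g - e k h| (_^-1).
  move=> a b c t c0 b0 t0 abc.
  case: (leP a t); case: (leP b t); case: (leP c t); lra.
move=> f U; split=> [fU|[r r0 rU]].
  have [n nU] := e_nbhs _ _ fU.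
  exists n.+1%:R^-1; first by rewrite invr_gt0.
  move=> g /= fgn; apply: nU => k kn.
  (* For [k < n] the truncation level [1/(k+1)] exceeds [1/(n+1)], so the minimum is the coordinate
     difference. *)
  have := le_lt_trans (gap_le f g k) fgn; rewrite gt_min => /orP[//|].
  by rewrite ltf_pV2 ?posrE // ltr_nat ltnNge ltnS (ltnW kn).
have r20 : 0 < r / 2 by rewrite divr_gt0.
have [n nr] : exists n : nat, n.+1%:R^-1 < r / 2.
  exists (Num.bound (r / 2)^-1).
  rewrite invf_plt ?posrE //; apply: lt_trans (archi_boundP _) _.
    by rewrite invr_ge0 ltW.
  by rewrite ltr_nat.
suff : \forall g \near f, forall k, (k < n)%N -> `|e k f - e k g| < r / 2.
  apply: filterS => g fg; apply: rU => /=.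
  (* A supremum inherits only weak inequalities, hence the margin [r / 2]. *)
  apply: (@le_lt_trans _ _ (r / 2)); last first.
    by rewrite ltr_pdivrMr // ltr_pMr // ltr1n.
  apply: gap_dist_le => k; rewrite ge_min.
  have [kn|nk] := ltnP k n; first by rewrite (ltW (fg _ kn)).
  apply/orP; right; apply: le_trans (ltW nr).
  by rewrite lef_pV2 ?posrE // ler_nat ltnS.
elim: n {nr} => [|n IH]; first exact: nearW.
have := @cvgr_dist_lt _ _ _ _ _ _ _ (e_cont n f) _ r20.
move=> fn; near=> g => k; rewrite ltnS leq_eqVlt => /predU1P[->|kn].
  by near: g; exact: fn.
move: kn; move: k; near: g; exact: IH.
Unshelve. all: by end_near. Qed.

End Metrization.

(** * Weak* closures in the dual unit ball *)

Lemma cvg_set_type (T : topologicalType) (A : set T) (F : set_system A)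
    (f : A) : Filter F -> set_val @ F --> set_val f -> F --> f.
Proof.
move=> FF Ff U [_ /= [[W oW <-]] /= Wf /filterS]; apply.
exact/Ff/open_nbhs_nbhs.
Qed.

Lemma dual_unit_ball_bounded (R : realType) (X : normedModType R)
    (f : {ptws X -> R^o}) : dual_unit_ball X f ->
  is_linear (f : X -> R) /\ bounded_by (f : X -> R) 1.
Proof.
move=> [flin fcont fnorm]; have flin' : is_linear (f : X -> R) by exact: flin.
split=> // x.
have f0 : (f : X -> R) 0 = 0.
  have := flin' 1 0 0; rewrite scaler0 addr0 mul1r => /eqP.
  by rewrite addrC -subr_eq subrr => /eqP.
have fZ a z : (f : X -> R) (a *: z) = a * (f : X -> R) z.
  by have := flin' a z 0; rewrite !addr0 f0 addr0.
have [r r0 fr] : exists2 r : R, 0 < r &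
    forall z : X, `|z| < r -> `|(f : X -> R) z| <= 1.
  have /cvgrPdist_lt/(_ 1 ltr01)/nbhs_ballP[r /= r0 rP] := fcont 0.
  exists r => // z zr.
  have := rP z; rewrite -ball_normE /= sub0r normrN => /(_ zr).
  by rewrite f0 sub0r normrN => /ltW.
have [->|x0] := eqVneq x 0; first by rewrite f0 !normr0 mulr0.
have nx0 : 0 < `|x| by rewrite normr_gt0.
have xE : x = `|x| *: (`|x|^-1 *: x).
  by rewrite scalerA divff ?gt_eqF // scale1r.
rewrite {1}xE fZ normrM normr_id mulrC; apply: ler_wpM2r => //.
apply: le_trans fnorm; apply: sup_upper_bound.
  split.
    by exists `|(f : X -> R) 0|; exists 0; rewrite //= normr0.
  (* Scaling the unit ball by [r / 2] puts it where [f] is at most 1 in absolute value. *)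
  exists (r / 2)^-1 => _ [z /= z1 <-].
  have r20 : 0 < r / 2 by rewrite divr_gt0.
  rewrite -[leRHS]mul1r ler_pdivlMr // mulrC -[X in X * _](gtr0_norm r20).
  rewrite -normrM -fZ; apply: fr; rewrite normrZ gtr0_norm //.
  apply: le_lt_trans (ler_wpM2l (ltW r20) z1) _.
  by rewrite mulr1 ltr_pdivrMr // ltr_pMr // ltr1n.
exists (`|x|^-1 *: x) => //=; rewrite normrZ normfV normr_id mulVf //.
by rewrite gt_eqF.
Qed.

Section Metrizable_closure.
Context (R : realType) (X : normedModType R).
Context (A : set (set_type (@dual_unit_ball R X))).
Context (g : nat -> X -> R) (w : nat -> X).
Hypothesis g_bounded : forall n, bounded_by (g n) 1.
Hypothesis A_g : forall a, A a -> exists n, g n = \val a.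

Let ball_ev (x : X) (h : set_type (@dual_unit_ball R X)) : R := \val h x.
Let ev (x : X) (f : set_type (closure A)) : R := ball_ev x (\val f).

Let ball_ev_continuous x : continuous (ball_ev x).
Proof.
move=> h; apply: (@continuous_comp _ _ _ set_val
  (fun u : {ptws X -> R^o} => u x)).
  exact: initial_continuous.
exact: (@proj_continuous X (fun=> R^o) x).
Qed.

Let ev_continuous x : continuous (ev x).
Proof.
move=> f; apply: (@continuous_comp _ _ _ set_val (ball_ev x)).
  exact: initial_continuous.
exact: ball_ev_continuous.
Qed.

Let ev_linear f a x y : ev (a *: x + y) f = a * ev x f + ev y f.
Proof.
have [flin _] := dual_unit_ball_bounded (set_mem (valP (\val f))).
exact: flin.
Qed.

Let ev_bounded f x : `|ev x f| <= `|x|.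
Proof.
have [_ fx] := dual_unit_ball_bounded (set_mem (valP (\val f))).
by apply: le_trans (fx x) _; rewrite mul1r.
Qed.

Let ev_approx f (s : seq X) (d : R) : 0 < d ->
  exists n, forall x, x \in s -> `|ev x f - g n x| < d.
Proof.
move=> d0; have /= fA := set_mem (valP f).
pose fb : set_type (@dual_unit_ball R X) := \val f.
have : \forall h \near fb, forall x, x \in s -> `|ev x f - ball_ev x h| < d.
  elim: s => [|y s IH]; first by apply: (@nearW _ (nbhs fb)) => h x.
  have /cvgrPdist_lt/(_ _ d0) fy := @ball_ev_continuous y fb.
  by apply: filterS2 fy IH => h hy hs x; rewrite in_cons => /predU1P[->|/hs].
move=> /fA[h [Ah hP]]; have [n gn] := A_g Ah; exists n => x /hP.
by rewrite gn.
Qed.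

(** The one index [n] sets both the number of coordinates and the precision. *)
Let agree n f h := forall k, (k < n)%N ->
  `|ev (w k) f - ev (w k) h| < n.+1%:R^-1.

Let agree_le n N f h : (n <= N)%N -> agree N f h -> agree n f h.
Proof.
move=> nN fh k kn; apply: lt_le_trans (fh k (leq_trans kn nN)) _.
by rewrite lef_pV2 ?posrE // ler_nat ltnS.
Qed.

(** This is continuity of the evaluation at [x] in the topology generated by the evaluations at the
    [w k]. *)
Let determined x := forall f (r : R), 0 < r ->
  exists n, forall h, agree n f h -> `|ev x f - ev x h| < r.

(** Discontinuity at [f] gives some [h] close to [f] at the first [w k] but at distance at least [r]
    from it at [z]. Approximate [f] and [h] by [g i] and [g j], and subtract from [g i - g j] a
    small interpolant of its values at the [w k]. The result vanishes there and stays large at [z];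
    dividing by its value at [z] gives a bound that does not depend on [n]. *)
Let far_from_undetermined z : ~ determined z -> far_from g w z.
Proof.
move=> /existsNP[f /existsNP[r /not_implyP[r0 /forallNP fr]]].
have {}fr n : exists2 h, agree n f h & r <= `|ev z f - ev z h|.
  have /existsNP[h /not_implyP[fh /negP]] := fr n.
  by rewrite -leNgt; exists h.
(* Before normalization the functional has bound 3 and absolute value at least [r / 2] at [z]. *)
exists (6 / r) => n; have [C C0 CP] := interpolation g_bounded w n.
have B0 : 0 <= (2 + 3 * C * `|z|) * (2 / r) + 3 * C.
  by rewrite addr_ge0 ?mulr_ge0 ?addr_ge0 ?mulr_ge0 ?invr_ge0 // ltW.
(* With [d = 1/(N+1)], the first summand keeps the loss at [z] below [r / 2] and the second keeps
   the norm of the interpolant at most 1. *)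
have [N nN NB] : exists2 N, (n <= N)%N &
    (2 + 3 * C * `|z|) * (2 / r) + 3 * C <= N.+1%:R.
  exists (maxn n (Num.bound ((2 + 3 * C * `|z|) * (2 / r) + 3 * C))).
    exact: leq_maxl.
  apply: le_trans (ltW (archi_boundP B0)) _.
  by rewrite ler_nat leqW // leq_maxr.
pose d : R := N.+1%:R^-1; have d0 : 0 < d by rewrite invr_gt0.
have dN : d * N.+1%:R = 1 by rewrite mulVf.
have [h fh fhz] := fr N.
have [i fi] := ev_approx f (z :: [seq w k | k <- iota 0 n]) d0.
have [j hj] := ev_approx h (z :: [seq w k | k <- iota 0 n]) d0.
have mw k : (k < n)%N -> w k \in z :: [seq w k | k <- iota 0 n].
  by move=> kn; rewrite in_cons map_f ?orbT // mem_iota.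
pose phi x := g i x + (-1) * g j x.
have phiA : combinations g phi.
  by apply: combinationsD; exact: combinations_gen.
(* One [d] comes from the agreement of [f] and [h], the other two from their approximations. *)
have [||chi [chiA chiE chiC]] := CP phi (3 * d) phiA.
- by rewrite mulr_ge0 // ltW.
- move=> k kn; have := fi _ (mw k kn); have := hj _ (mw k kn).
  have := fh k (leq_trans kn nN); rewrite -/d /phi => H1 H2 H3.
  rewrite (_ : _ + _ = (ev (w k) f - ev (w k) h) - (ev (w k) f - g i (w k)) +
    (ev (w k) h - g j (w k))); last by lra.
  apply: le_trans (ler_normD _ _) _.
  apply: le_trans (lerD (ler_normB _ _) (lexx _)) _; lra.
pose a x := phi x + (-1) * chi x.
have aA : combinations g a by exact: combinationsD.
have := ler_wpM2r (ltW d0) NB; rewrite mulrC in dN; rewrite dN mulrDl => NBd.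
have P0 : 0 <= (2 + 3 * C * `|z|) * (2 / r) * d.
  by rewrite !mulr_ge0 ?addr_ge0 ?mulr_ge0 ?invr_ge0 // ltW.
have Q0 : 0 <= 3 * C * d by rewrite !mulr_ge0 // ltW.
have K1 : 3 * C * d <= 1 by lra.
have K2 : (2 + 3 * C * `|z|) * d <= r / 2.
  have r20 : 0 <= r / 2 by rewrite divr_ge0 // ltW.
  have P1 : (2 + 3 * C * `|z|) * (2 / r) * d <= 1 by lra.
  have := ler_wpM2r r20 P1; rewrite mul1r; apply: le_trans.
  rewrite le_eqVlt; apply/orP; left; apply/eqP; field.
  by rewrite gt_eqF.
have a3 : bounded_by a 3.
  apply: bounded_by_le
    (bounded_byD (-1) (bounded_byD (-1) (g_bounded i) (g_bounded j)) chiC).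
  rewrite normrN normr1 !mul1r; lra.
have az : r / 2 <= `|a z|.
  have Hi := fi z (mem_head _ _); have Hj := hj z (mem_head _ _).
  have Hc := chiC z.
  have : `|ev z f - ev z h| <= `|a z| + `|ev z f - g i z| +
      `|ev z h - g j z| + `|chi z|.
    rewrite (_ : ev z f - ev z h = a z + (ev z f - g i z) -
      (ev z h - g j z) + chi z); last by rewrite /a /phi; lra.
    apply: le_trans (ler_normD _ _) _; rewrite lerD2r.
    apply: le_trans (ler_normB _ _) _; rewrite lerD2r.
    exact: ler_normD.
  rewrite (_ : C * (3 * d) * `|z| = 3 * C * `|z| * d) in Hc; last by lra.
  lra.
have az0 : 0 < `|a z| by apply: lt_le_trans az; rewrite divr_gt0.
exists (fun x => (a z)^-1 * a x); split.
- exact: combinationsZ.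
- move=> x; rewrite normrM normfV mulrC ler_pdivrMr //.
  apply: le_trans (a3 x) _; rewrite mulrAC; apply: ler_wpM2r => //.
  rewrite -[leLHS](_ : 6 / r * (r / 2) = 3); last by field; rewrite gt_eqF.
  by apply: ler_wpM2l => //; rewrite divr_ge0 // ltW.
- by move=> k kn; rewrite {2}/a chiE // mulN1r subrr mulr0.
- by rewrite mulVf // -normr_gt0.
Qed.

(** The determined points form a closed linear subspace containing [Z], hence all of [X]. The
    coordinates [w k] then separate points and give the weak* topology. *)
Lemma metrizable_closure (Z : set X) : dense (lin_span Z) ->
  (forall z, Z z -> ~ far_from g w z) -> metrizable R (set_type (closure A)).
Proof.
move=> Zd Zfar.
have Zdet z : Z z -> determined z.
  by move=> /Zfar; apply: contra_notP => /far_from_undetermined.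
have det0 f : ev 0 f = 0.
  by apply/eqP; have := ev_bounded f 0; rewrite normr0 normr_le0.
have det_lin a x y : determined x -> determined y -> determined (a *: x + y).
  move=> dx dy f r r0.
  have r20 : 0 < r / 2 by rewrite divr_gt0.
  have ra0 : 0 < r / 2 / (`|a| + 1) by rewrite divr_gt0 // ltr_wpDl.
  have [n nP] := dx f _ ra0; have [m mP] := dy f _ r20.
  exists (maxn n m) => h fh; rewrite !ev_linear.
  have := nP _ (agree_le (leq_maxl _ _) fh).
  have := mP _ (agree_le (leq_maxr _ _) fh) => H1 H2.
  rewrite opprD addrACA -mulrBr; apply: le_lt_trans (ler_normD _ _) _.
  rewrite normrM [ltRHS]splitr; apply: ler_ltD => //.
  apply: le_trans (ler_wpM2l (normr_ge0 a) (ltW H2)) _.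
  rewrite mulrA ler_pdivrMr ?ltr_wpDl // mulrC.
  apply: ler_wpM2l; first exact: ltW.
  by rewrite lerDl.
have det_span x : lin_span Z x -> determined x.
  move=> [n [a [z [zZ ->]]]]; elim/big_rec: _ => [f r r0|i y _ dy].
    by exists 0%N => h _; rewrite !det0 subrr normr0.
  by apply: det_lin => //; exact: Zdet.
(* Members of the ball are 1-Lipschitz, so replacing [x] by a nearby [y] costs less than [r / 3] for
   each of [f] and [h]. *)
have det x : determined x.
  move=> f r r0; have r30 : 0 < r / 3 by rewrite divr_gt0.
  have [y [/= yx /det_span dy]] : ball x (r / 3) `&` lin_span Z !=set0.
    by apply: Zd; [exists x; exact: ballxx | exact: ball_open].
  have [n nP] := dy f _ r30; exists n => h /nP fh.
  move: yx; rewrite -ball_normE /= => yx.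
  have evB u : ev (x - y) u = ev x u - ev y u.
    by rewrite addrC -scaleN1r ev_linear mulN1r addrC.
  have Hf := ev_bounded f (x - y); have Hh := ev_bounded h (x - y).
  rewrite (_ : ev x f - ev x h =
      ev (x - y) f + (ev y f - ev y h) - ev (x - y) h).
    apply: le_lt_trans (ler_normB _ _) _.
    apply: le_lt_trans (lerD (ler_normD _ _) (lexx _)) _; lra.
  by rewrite !evB; lra.
apply: (@metrizable_countable_separation _ _ (fun k => ev (w k))).
- by move=> k; exact: ev_continuous.
- move=> f h fh; apply/val_inj/val_inj/funext => x.
  apply/eqP; rewrite -subr_eq0 -normr_le0 leNgt; apply/negP => xfh.
  have [n nP] := det x f _ xfh.
  have : `|ev x f - ev x h| < `|ev x f - ev x h|; last by rewrite ltxx.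
  by apply: nP => k _; rewrite fh subrr normr0 invr_gt0.
move=> f U fU.
(* The sets [agree n f] generate a filter, and pointwise convergence of this filter to [f] is
   determination of every [x]. *)
pose F : set_system (set_type (closure A)) :=
  [set V | exists n, forall h, agree n f h -> V h].
suff : F U by [].
have FF : Filter F.
  split.
  - by exists 0%N.
  - move=> P Q [n nP] [m mQ]; exists (maxn n m) => h fh; split.
      exact/nP/(agree_le _ fh)/leq_maxl.
    exact/mQ/(agree_le _ fh)/leq_maxr.
  - by move=> P Q PQ [n nP]; exists n => h /nP/PQ.
suff : F --> f by exact.
(* Twice, since the closure is a subspace of the ball and the ball a subspace of the product. *)
apply: cvg_set_type; apply: cvg_set_type; apply/pointwise_cvgP => x.
apply/cvgrPdist_lt => r r0; have [n nP] := det x f r r0.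
by exists n => h /nP.
Qed.

End Metrizable_closure.

(** * Uncountable sets and countable initial segments *)

Lemma uncountableD (T : Type) (A B : set T) :
  ~ countable A -> countable B -> ~ countable (A `\` B).
Proof.
move=> Ac Bc ABc; apply: Ac.
apply: (@sub_countable _ _ _
  (\bigcup_(b in [set: bool]) if b then A `\` B else B)).
  apply: subset_card_le => x Ax; have [Bx|Bx] := pselect (B x).
    by exists false.
  by exists true.
by apply: bigcup_countable => // -[].
Qed.

Lemma uncountable_neq0 (T : Type) (A : set T) : ~ countable A -> A !=set0.
Proof. by move=> Ac; apply/set0P/eqP => A0; apply: Ac; rewrite A0. Qed.

(** This stands in for an enumeration in type omega_1: well-order [T] and, if some initial segment
    of [W] is uncountable, cut [W] at the least point with such a segment. *)
Lemma countable_initial_segments (T : eqType) (W : set T) : ~ countable W ->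
  exists (V : set T) (S : T -> set T), [/\ V `<=` W, ~ countable V,
    forall x, V x -> countable (S x) &
    forall x y, V x -> V y -> S x y \/ S y x].
Proof.
move=> Wc; have [r r_wo] := wochoice.well_ordering_principle T.
have r_total x y : r x y \/ r y x.
  have [|z [[]]] := r_wo (pred2 x y); first by exists x; rewrite inE eqxx.
  rewrite inE => /orP[]/eqP-> zl _; [left|right]; apply: zl;
    by rewrite inE eqxx ?orbT.
have r_anti x y : r x y -> r y x -> x = y.
  move=> xy yx; have [|z [_ zu]] := r_wo (pred2 x y).
    by exists x; rewrite inE eqxx.
  have [xx yy] : r x x /\ r y y.
    by split; [case: (r_total x x)|case: (r_total y y)].
  have -> : x = z.
    by apply/esym/zu; split=> [|u]; rewrite inE ?eqxx // => /orP[]/eqP->.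
  by apply: zu; split=> [|u]; rewrite inE ?eqxx ?orbT // => /orP[]/eqP->.
pose S x := [set y | W y /\ r y x].
have [[x0 Sx0]|Sc] := pselect (exists x, ~ countable (S x)); last first.
  exists W, S; split=> // [x Wx|x y Wx Wy].
    by apply: contrapT => xc; apply: Sc; exists x.
  by case: (r_total x y); [right|left].
pose big : {pred T} := [pred x | `[< ~ countable (S x) >]].
have [|x [[/asboolP xbig xmin] _]] := r_wo big.
  by exists x0; exact/asboolP.
exists (S x `\ x), S; split.
- by move=> y [[]].
- exact: uncountableD.
- move=> y [[Wy yx] /= nyx]; apply: contrapT => yc; apply: nyx.
  by apply: r_anti => //; apply: xmin; exact/asboolP.
- move=> y z [[Wy _] _] [[Wz _] _].
  by case: (r_total y z); [right|left].
Qed.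

(** * Condensation and interpolation on finite sets *)

Section Forcing.
Context (R : realType) (X : normedModType R) (g : nat -> X -> R) (m : R).
Hypothesis g_bounded : forall n, bounded_by (g n) 1.
Hypothesis m_ge0 : 0 <= m.

Lemma finitely_separated_le (V : set X) y :
  finitely_separated g m V -> V y -> `|y| <= m.
Proof.
move=> Vsep Vy; have [|s ssep sy] := Vsep [fset y]%fset.
  by move=> x; rewrite in_fset1 => /eqP->.
have : y \in s by rewrite sy in_fset1.
elim: s {sy} ssep => //= z s IH [zm ssep _].
by rewrite in_cons => /predU1P[->//|]; exact: IH.
Qed.

(** As in the Cantor-Bendixson argument, delete every countable set among the countably many [U i]
    given by rational combinations and radii [1/(n+1)]. A point that is left lies only in
    uncountable ones. *)
Lemma condensation_subset (V : set X) :
  ~ countable V -> (forall y, V y -> `|y| <= m) ->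
  exists W, [/\ W `<=` V, ~ countable W &
    forall phi y (d : R), combinations g phi -> W y -> phi y = 0 -> 0 < d ->
      ~ countable [set z | W z /\ `|phi z| < d]].
Proof.
move=> Vc Vm.
pose U (i : seq (nat * rat) * nat) := [set z | V z /\
  `|combination g [seq (p.1, ratr p.2) | p <- i.1] z| < i.2.+1%:R^-1].
pose N := \bigcup_(i in [set i | countable (U i)]) U i.
have Nc : countable N by exact: bigcup_countable.
exists (V `\` N); split; [by move=> x []|exact: uncountableD|].
move=> phi y d pA [Vy Ny] py0 d0.
have [j jd] : exists j : nat, 2 / d <= j.+1%:R.
  exists (Num.bound (2 / d)); apply: le_trans (ltW (archi_boundP _)) _.
    by rewrite divr_ge0 // ltW.
  by rewrite ler_nat.
have jd' : 2 * j.+1%:R^-1 <= d.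
  by rewrite ler_pdivrMr // mulrC -ler_pdivrMr.
have m1 : 0 < m + 1 by rewrite ltr_wpDl.
(* On vectors of norm at most [m] this precision gives an error below [1/(j+1)]; two such errors add
   up to at most [d]. *)
have e0 : 0 < j.+1%:R^-1 / (m + 1) by rewrite divr_gt0.
have [l lP] := combinations_separable g_bounded pA e0.
have close z : V z ->
    `|phi z - combination g [seq (p.1, ratr p.2) | p <- l] z| < j.+1%:R^-1.
  move=> Vz; apply: le_lt_trans (lP z) _.
  rewrite mulrAC ltr_pdivrMr // ltr_pM2l ?invr_gt0 //.
  by apply: le_lt_trans (Vm _ Vz) _; rewrite ltrDl.
have Uy : U (l, j) y.
  by split=> //=; have := close y Vy; rewrite py0 sub0r normrN.
have Uc : ~ countable (U (l, j)) by move=> Uc; apply: Ny; exists (l, j).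
apply: contra_not (uncountableD Uc Nc); apply: sub_countable.
apply: subset_card_le => z [[Vz /= Uz] Nz]; split=> //.
have := close z Vz; move: Uz.
set b := combination _ _ _ => Uz Cz.
rewrite -(subrK b (phi z)); apply: le_lt_trans (ler_normD _ _) _.
by apply: lt_le_trans jd'; rewrite mulr_natl mulr2n ltrD.
Qed.

Lemma fset_interpolation (V : set X) k : finitely_separated g m V ->
  exists2 C : R, 0 <= C & forall (F : {fset X}) (v : X -> R) (d : R),
    (forall x, x \in F -> V x) -> (#|` F| <= k)%N -> 0 <= d ->
    (forall x, x \in F -> `|v x| <= d) ->
  exists chi, [/\ combinations g chi,
    forall x, x \in F -> chi x = v x & bounded_by chi (C * d)].
Proof.
move=> Vsep; have [C C0 CP] := separated_interpolation g k m_ge0.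
exists C => // F v d FV Fk d0 vd; have [s ssep sF] := Vsep F FV.
have sk : (size s <= k)%N.
  have us := separated_uniq ssep.
  by rewrite (perm_size (uniq_perm us (fset_uniq F) sF)).
have [x|chi [cA cv cC]] := CP s v d ssep sk d0; first by rewrite sF; exact: vd.
by exists chi; split=> // x xF; apply: cv; rewrite sF.
Qed.

End Forcing.

(** * The partial order of conditions *)

Section Order.
Context (R : realType) (X : normedModType R).

(* The condition (phi, F, r) promises a functional at distance at most r from
   phi that vanishes on the finite set F. *)
Definition condition : Type := (X -> R) * {fset X} * R.

(** The last clause makes the ball of radius [p.2] about the functional of [p] lie inside the ball
    of [q]. *)
Definition stronger (p q : condition) : Prop :=
  [/\ (q.1.2 `<=` p.1.2)%fset, p.2 <= q.2 &
      bounded_by (fun x => p.1.1 x - q.1.1 x) (q.2 - p.2)].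

Lemma stronger_refl p : stronger p p.
Proof. by split=> // x; rewrite !subrr normr0 mul0r. Qed.

Lemma stronger_anti p q : stronger p q -> stronger q p -> p = q.
Proof.
case: p q => [[phi F] r] [[psi G] r'] [/= FG rr pq] [/= GF rr' _].
have {rr rr'} rE : r = r' by apply/eqP; rewrite eq_le rr rr'.
have -> : phi = psi.
  apply/funext => x; apply/eqP; rewrite -subr_eq0 -normr_le0.
  by apply: le_trans (pq x) _; rewrite rE subrr mul0r.
by congr (_, _, _) => //; apply/eqP; rewrite eqEfsubset FG GF.
Qed.

Lemma stronger_trans q p r : stronger p q -> stronger q r -> stronger p r.
Proof.
move=> [qp pq2 pq] [rq qr2 qr]; split.
- exact: fsubset_trans qp.
- exact: le_trans qr2.
- move=> x; apply: le_trans (ler_distD (q.1.1 x) _ _) _.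
  have -> : r.2 - p.2 = (q.2 - p.2) + (r.2 - q.2) by lra.
  by rewrite mulrDl; exact: lerD.
Qed.

Definition forcing_poset (Q : set condition) : Type := set_type Q.
HB.instance Definition _ Q := Choice.on (forcing_poset Q).

Section Poset.
Context (Q : set condition).

Let le (p q : forcing_poset Q) : bool := `[< stronger (\val p) (\val q) >].

Let le_refl : reflexive le.
Proof. by move=> p; apply/asboolP/stronger_refl. Qed.

Let le_anti : antisymmetric le.
Proof.
by move=> p q /andP[/asboolP pq /asboolP qp]; exact/val_inj/stronger_anti.
Qed.

Let le_trans : transitive le.
Proof.
move=> q p r /asboolP pq /asboolP qr.
by apply/asboolP; exact: stronger_trans qr.
Qed.

HB.instance Definition _ := Order.Le_isPOrder.Build (Order.Disp tt tt)
  (forcing_poset Q) le_refl le_anti le_trans.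

Lemma forcing_posetP (p q : forcing_poset Q) :
  (p <= q)%O <-> stronger (\val p) (\val q).
Proof. by split=> [/asboolP|/asboolP]. Qed.

End Poset.
End Order.

(** * Chain condition, dense sets and the generic functional *)

Section Generic.
Context (R : realType) (X : normedModType R) (g : nat -> X -> R) (m : R).
Context (V : set X) (x0 : X).
Hypothesis g_linear : forall n, is_linear (g n).
Hypothesis g_bounded : forall n, bounded_by (g n) 1.
Hypothesis m_ge0 : 0 <= m.
Hypothesis V_sep : finitely_separated g m V.

(* The last clause keeps the generic functional at least [1] at [x0]; the bound
   on the product of [p.2] and the size of the finite set makes the radii tend
   to [0] along a filter whose finite sets have an infinite union. *)
Definition forcing_conditions : set (condition X) :=
  [set p | [/\ combinations g p.1.1, p.1.2 != fset0,
    forall x, x \in p.1.2 -> V x /\ p.1.1 x = 0,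
    0 < p.2 /\ p.2 * #|` p.1.2|%:R <= 1 &
    1 <= p.1.1 x0 - p.2 * `|x0|]].

Local Notation P := (forcing_poset forcing_conditions).

(** Of the radius of [p], [C * d] pays for making the functional vanish on [F], and [e] is kept.
    This serves both to amalgamate two conditions and to add a single point. *)
Definition extension_bound (k : nat) (C : R) : Prop := 0 <= C /\
  forall (p : condition X) (F : {fset X}) (d e : R), forcing_conditions p ->
    (p.1.2 `<=` F)%fset -> (forall x, x \in F -> V x) -> (#|` F| <= k)%N ->
    0 <= d -> (forall x, x \in F -> `|p.1.1 x| <= d) ->
    0 < e -> e * k%:R <= 1 -> C * d + e <= p.2 ->
  exists psi, [/\ forcing_conditions (psi, F, e), stronger (psi, F, e) p &
    bounded_by (fun x => psi x - p.1.1 x) (C * d)].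

(** Subtract an interpolant of the values on [F]. The clause at [x0] survives because the value
    there drops by at most [C * d * |x0|] while the radius shrinks by at least [C * d]. *)
Lemma condition_extension k : exists C, extension_bound k C.
Proof.
have [C C0 CP] := fset_interpolation m_ge0 k V_sep.
exists C; split=> // -[[phi G] r] F d e [/= pA G0 GV [r0 rG] px0].
move=> GF FV Fk d0 Fd e0 ek Cde.
have [chi [cA cphi cC]] := CP F phi d FV Fk d0 Fd.
have psiE x : phi x + (-1) * chi x - phi x = - chi x by lra.
have psi_bound : bounded_by (fun x => phi x + (-1) * chi x - phi x) (C * d).
  by move=> x; rewrite psiE normrN.
exists (fun x => phi x + (-1) * chi x); split=> //; split=> //=.
- exact: combinationsD.
- by apply: contra_neq G0 => F0; apply/eqP; rewrite -fsubset0 -F0.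
- by move=> x xF; split; [exact: FV|rewrite cphi // mulN1r subrr].
- split=> //; apply: le_trans ek; apply: ler_wpM2l; first exact: ltW.
  by rewrite ler_nat.
- have := cC x0; rewrite ler_norml => /andP[_ cx0].
  have := ler_wpM2r (normr_ge0 x0) Cde; rewrite mulrDl; lra.
- by apply: le_trans Cde; rewrite lerDr mulr_ge0.
- by apply: bounded_by_le psi_bound; rewrite lerBrDr.
Qed.

(* Conditions with equally large finite sets, radii bounded below and nearby
   functionals are compatible, and by separability these are countably many
   classes. *)
Lemma forcing_ccc : ccc P.
Proof.
have [C CP] := choice condition_extension.
(* Chosen so that [dist + C * (dist * m)] is half of [1/(j+1)], a lower bound for the radii. A union
   of two [k]-element sets has at most [k + k] points, and on those of [q] the functional of [p] is
   at most [dist * m]. *)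
pose dist (k j : nat) : R := j.+1%:R^-1 / 2 / (1 + C (k + k)%N * m).
have cm k : 0 < 1 + C (k + k)%N * m.
  by rewrite ltr_pwDl // mulr_ge0 //; have [] := CP (k + k)%N.
have dist0 k j : 0 < dist k j by rewrite !divr_gt0.
have /choice[code codeP] (p : P) : exists c : nat * nat * seq (nat * rat),
    [/\ #|` (\val p).1.2| = c.1.1, c.1.2.+1%:R^-1 <= (\val p).2 &
      bounded_by (fun x => (\val p).1.1 x -
        combination g [seq (q.1, ratr q.2) | q <- c.2] x)
        (dist c.1.1 c.1.2 / 2)].
  have [pA _ _ [p0 _] _] := set_mem (valP p).
  pose j := Num.bound (\val p).2^-1.
  have d20 : 0 < dist #|` (\val p).1.2| j / 2 by rewrite divr_gt0.
  have [l lP] := combinations_separable g_bounded pA d20.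
  exists (#|` (\val p).1.2|, j, l); split=> //=.
  rewrite invf_ple ?posrE //; apply: le_trans (ltW (archi_boundP _)) _.
    by rewrite invr_ge0 ltW.
  by rewrite ler_nat.
move=> A Aanti; apply/countable_injP; exists (choice.pickle \o code) => p q.
rewrite !inE => Ap Aq /(pcan_inj choice.pickleK) pq; apply: Aanti => //.
have [pk pj pl] := codeP p; have [qk qj ql] := codeP q.
move: pk pj pl qk qj ql; rewrite pq; case: (code q) => [[k j] l] /=.
move=> pk pj pl qk qj ql {pq}.
have [pC0 pCP] := CP (k + k)%N.
have pc := set_mem (valP p); have qc := set_mem (valP q).
have [_ _ pV _ _] := pc; have [_ _ qV _ _] := qc.
have pq x : `|(\val p).1.1 x - (\val q).1.1 x| <= dist k j * `|x|.
  apply: le_trans (ler_distD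
    (combination g [seq (q.1, ratr q.2) | q <- l] x) _ _) _.
  have := pl x; have := ql x; rewrite [ `|_ - (\val q).1.1 x|]distrC; lra.
pose F := ((\val p).1.2 `|` (\val q).1.2)%fset.
(* The other half of the radius, capped so that [e] times the size of [F] is at most 1. *)
pose e : R := Num.min (j.+1%:R^-1 / 2) (k + k).+1%:R^-1.
have e0 : 0 < e by rewrite lt_min divr_gt0 ?invr_gt0 ?ltr0Sn.
have ek : e * (k + k)%:R <= 1.
  apply: (@le_trans _ _ ((k + k).+1%:R^-1 * (k + k).+1%:R)); last first.
    by rewrite mulVf.
  by apply: ler_pM => //; [exact: ltW|rewrite ge_min lexx orbT|rewrite ler_nat].
have dE : dist k j + C (k + k)%N * (dist k j * m) = j.+1%:R^-1 / 2.
  have -> : dist k j + C (k + k)%N * (dist k j * m) =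
    dist k j * (1 + C (k + k)%N * m) by ring.
  by rewrite divfK // gt_eqF.
have De : dist k j + C (k + k)%N * (dist k j * m) + e <= j.+1%:R^-1.
  by rewrite dE [leRHS]splitr lerD2l ge_min lexx.
have D0 : 0 <= C (k + k)%N * (dist k j * m).
  by apply: mulr_ge0 => //; apply: mulr_ge0 => //; exact: ltW.
have Dp := le_trans De pj; have Dq := le_trans De qj.
have [||||||||psi [psic psip psib]] :=
  pCP (\val p) F (dist k j * m) e pc => //.
- exact: fsubsetUl.
- by move=> x; rewrite in_fsetU => /orP[/pV[]|/qV[]].
- by rewrite -{1}pk -qk leq_card_fsetU.
- by rewrite mulr_ge0 // ltW.
- move=> x; rewrite in_fsetU => /orP[/pV[_ ->]|/qV[Vx qx]].
    by rewrite normr0 mulr_ge0 // ltW.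
  have := pq x; rewrite qx subr0 => /le_trans; apply.
  apply: ler_wpM2l; first exact: ltW.
  exact: finitely_separated_le V_sep Vx.
- by have := dist0 k j; lra.
exists (exist _ (psi, F, e) (mem_set psic)); split; apply/forcing_posetP => //.
split=> /=; first exact: fsubsetUr.
  by have := dist0 k j; lra.
move=> x; apply: le_trans (ler_distD ((\val p).1.1 x) _ _) _.
have := psib x; have := pq x => H1 H2.
have : (dist k j + C (k + k)%N * (dist k j * m)) * `|x| <=
    ((\val q).2 - e) * `|x| by apply: ler_wpM2r => //; lra.
by rewrite mulrDl; lra.
Qed.

Lemma forcing_nonempty y0 : V x0 -> V y0 -> y0 != x0 -> [set: P] !=set0.
Proof.
move=> Vx0 Vy0 yx; have [C C0 CP] := fset_interpolation m_ge0 2 V_sep.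
pose v x : R := if x == x0 then 2 else 0.
have [x||//||phi [pA pE _]] := CP [fset y0; x0]%fset v 2.
- by rewrite in_fset2 => /orP[]/eqP->.
- by rewrite cardfs2 ltnS leq_b1.
- by move=> x _; rewrite /v; case: ifP; rewrite ?normr0 // ger0_norm.
have px : phi x0 = 2 by rewrite pE ?in_fset2 ?eqxx ?orbT // /v eqxx.
have py : phi y0 = 0 by rewrite pE ?in_fset2 ?eqxx // /v (negbTE yx).
(* From the value 2 at [x0] this radius takes away at most 1. *)
pose e : R := (`|x0| + 1)^-1.
have e0 : 0 < e by rewrite invr_gt0 ltr_wpDl.
have ex : e * (`|x0| + 1) = 1 by rewrite mulVf // gt_eqF // ltr_wpDl.
have : forcing_conditions (phi, [fset y0]%fset, e).
  split=> //=.
  - by apply/fset0Pn; exists y0; rewrite in_fset1.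
  - by move=> x; rewrite in_fset1 => /eqP->.
  - split=> //; rewrite cardfs1 mulr1 -[leRHS]ex ler_peMr ?(ltW e0) //.
    by rewrite lerDr.
  - by move: ex; rewrite mulrDr mulr1 px; lra.
by move=> /mem_set pc; exists (exist _ (phi, [fset y0]%fset, e) pc).
Qed.

Hypothesis V_condensed : forall phi y (d : R), combinations g phi -> V y ->
  phi y = 0 -> 0 < d -> ~ countable [set z | V z /\ `|phi z| < d].

(** The functional of [p] vanishes at some point of [V], so by condensation it is below [d] at
    uncountably many points of [V]. One of them lies outside [S] and can be added. *)
Lemma forcing_dense_avoid (S : set X) : countable S ->
  forcing_dense [set p : P | exists2 y, y \in (\val p).1.2 & ~ S y].
Proof.
move=> Sc p; have pc := set_mem (valP p).
have [pA /fset0Pn[y yF] pV [p0 _] _] := pc.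
pose k := #|` (\val p).1.2|.+1.
have [C [C0 CP]] := condition_extension k.
(* Half of the radius covers [C * d], and the other half covers the new radius [e]. *)
pose d := (\val p).2 / 2 / (C + 1).
have C1 : 0 < C + 1 by rewrite ltr_wpDl.
have d0 : 0 < d by rewrite !divr_gt0.
have [Vy py] := pV y yF.
have [z [[Vz pz] Sz]] :=
  uncountable_neq0 (uncountableD (V_condensed pA Vy py d0) Sc).
pose e : R := Num.min ((\val p).2 / 2) k%:R^-1.
have e0 : 0 < e by rewrite lt_min divr_gt0 ?invr_gt0 ?ltr0Sn.
have dE : C * d + d = (\val p).2 / 2.
  by rewrite /d; field; rewrite gt_eqF.
have ep : e <= (\val p).2 / 2 by rewrite ge_min lexx.
have [||||||||psi [psic psip _]] :=
  CP (\val p) (z |` (\val p).1.2)%fset d e pc => //.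
- exact: fsubsetUr.
- by move=> x; rewrite in_fset1U => /predU1P[->//|/pV[]].
- by rewrite cardfsU1 /k -[leqRHS]add1n leq_add2r leq_b1.
- exact: ltW.
- move=> x; rewrite in_fset1U => /predU1P[->|/pV[_ ->]]; first exact: ltW.
  by rewrite normr0 ltW.
- apply: (@le_trans _ _ (k%:R^-1 * k%:R)); last by rewrite mulVf ?pnatr_eq0.
  by apply: ler_wpM2r => //; rewrite ge_min lexx orbT.
- by lra.
exists (exist _ (psi, (z |` (\val p).1.2)%fset, e) (mem_set psic)).
  by exists z => //=; rewrite in_fset1U eqxx.
exact/forcing_posetP.
Qed.

(** The functionals in the filter form a Cauchy net because the radii tend to 0; [f] is its
    limit. *)
Lemma generic_functional (G : set P) : forcing_filter G ->
  ~ countable [set y | exists2 p, G p & y \in (\val p).1.2] ->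
  exists f : X -> R, [/\ is_linear f, exists B, bounded_by f B, 1 <= f x0 &
    forall y, (exists2 p, G p & y \in (\val p).1.2) -> f y = 0].
Proof.
move=> [[p0 Gp0] _ Gdir] Gunc.
pose phi (p : P) := (\val p).1.1; pose rad (p : P) := (\val p).2.
have rad0 p : 0 < rad p by have [_ _ _ []] := set_mem (valP p).
have Gmeet p q : G p -> G q ->
    exists r : P,
      [/\ G r, stronger (\val r) (\val p) & stronger (\val r) (\val q)].
  move=> Gp Gq; have [r Gr] := Gdir p q Gp Gq.
  by move=> [/forcing_posetP rp /forcing_posetP rq]; exists r.
have overlap p q x : G p -> G q ->
    phi p x - rad p * `|x| <= phi q x + rad q * `|x|.
  move=> Gp Gq; have [r [Gr [_ _ rp] [_ _ rq]]] := Gmeet p q Gp Gq.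
  have := rp x; have := rq x; rewrite !ler_norml -/(phi p) -/(phi q) -/(rad p).
  rewrite -/(rad q) -/(rad r) -/(phi r) => /andP[H1 H2] /andP[H3 H4].
  by have := mulr_ge0 (ltW (rad0 r)) (normr_ge0 x); lra.
(* By directedness the finite sets in [G] become arbitrarily large, and radius times size is at most
   1. *)
have small (e : R) : 0 < e -> exists2 p, G p & rad p < e.
  move=> e0; suff [p Gp pe] : exists2 p, G p & e^-1 < #|` (\val p).1.2|%:R.
    exists p => //; have [_ _ _ [_ pF] _] := set_mem (valP p).
    have F0 : 0 < #|` (\val p).1.2|%:R :> R.
      by apply: lt_trans pe; rewrite invr_gt0.
    have : rad p <= #|` (\val p).1.2|%:R^-1.
      by rewrite -[leRHS]mul1r ler_pdivlMr.
    by move/le_lt_trans; apply; rewrite invf_plt.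
  suff /(_ (Num.bound e^-1))[p Gp pn] : forall n,
      exists2 p, G p & (n <= #|` (\val p).1.2|)%N.
    exists p => //; apply: lt_le_trans (archi_boundP _) _.
      by rewrite invr_ge0 ltW.
    by rewrite ler_nat.
  elim=> [|n [p Gp pn]]; first by exists p0.
  have [y [[q Gq yq] /= yp]] := uncountable_neq0
    (uncountableD Gunc (countable_fset (\val p).1.2)).
  have [r [Gr [pr _ _] [qr _ _]]] := Gmeet p q Gp Gq; exists r => //.
  apply: leq_trans (fsubset_leq_card (_ : y |` (\val p).1.2 `<=` _)%fset).
    by rewrite cardfsU1; move/negP: yp => ->.
  apply/fsubsetP => z; rewrite in_fset1U => /predU1P[->|].
    exact: (fsubsetP qr).
  exact: (fsubsetP pr).
(* Each [p] confines the limit at [x] to an interval about [phi p x]; these intervals meet pairwise,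
   and [f x] is the supremum of their left endpoints. *)
pose f x := sup [set phi p x - rad p * `|x| | p in G].
have fP p x : G p -> `|f x - phi p x| <= rad p * `|x|.
  move=> Gp; rewrite ler_distl; apply/andP; split.
    apply: sup_upper_bound; last by exists p.
    split; first by exists (phi p x - rad p * `|x|); exists p.
    by exists (phi p x + rad p * `|x|) => _ [q Gq <-]; exact: overlap.
  apply: ge_sup; first by exists (phi p x - rad p * `|x|); exists p.
  by move=> _ [q Gq <-]; exact: overlap.
have vanish (z c : R) : 0 <= c -> (forall p, G p -> `|z| <= rad p * c) -> z = 0.
  move=> c0 zc; apply/eqP; rewrite -normr_le0 leNgt; apply/negP => z0.
  have c1 : 0 < c + 1 by rewrite ltr_wpDl.
  have [|p Gp pe] := small (`|z| / (c + 1)); first by rewrite divr_gt0.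
  move: pe; rewrite ltr_pdivlMr // mulrDr mulr1 => pe.
  by have := zc p Gp; have := rad0 p; lra.
exists f; split.
- move=> a x y; apply/eqP; rewrite -subr_eq0; apply/eqP.
  apply: (vanish _ (`|a *: x + y| + `|a| * `|x| + `|y|)).
    by rewrite !addr_ge0 // mulr_ge0.
  move=> p Gp; have [pA _ _ _ _] := set_mem (valP p).
  have pl := combinations_linear g_linear pA a x y.
  rewrite (_ : _ - _ = (f (a *: x + y) - phi p (a *: x + y)) -
    a * (f x - phi p x) - (f y - phi p y)); last first.
    by rewrite /phi pl; lra.
  apply: le_trans (ler_normB _ _) _; rewrite !(mulrDr (rad p)).
  apply: lerD (fP p y Gp); apply: le_trans (ler_normB _ _) _.
  apply: lerD; first exact: fP.
  by rewrite normrM mulrCA; apply: ler_wpM2l => //; exact: fP.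
- have [pA _ _ _ _] := set_mem (valP p0).
  have [B B0 pB] := combinations_bounded g_bounded pA.
  exists (rad p0 + B) => x; rewrite mulrDl -(subrK (phi p0 x) (f x)).
  by apply: le_trans (ler_normD _ _) _; apply: lerD; [exact: fP|exact: pB].
- have [_ _ _ _ p1] := set_mem (valP p0); apply: le_trans p1 _.
  by have := fP p0 x0 Gp0; rewrite ler_distl => /andP[].
- move=> y [p Gp yp]; apply: (vanish _ `|y|) => // q Gq.
  (* A common extension [r] has [y] in its finite set and radius at most that of [q]. *)
  have [r [Gr [pr _ _] [_ rq _]]] := Gmeet p q Gp Gq.
  have [_ _ /(_ y) rV _ _] := set_mem (valP r).
  have [|_ ry] := rV; first exact: (fsubsetP pr).
  have := fP r y Gr; rewrite /phi ry subr0 => /le_trans; apply.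
  exact: ler_wpM2r.
Qed.

Hypothesis V_uncountable : ~ countable V.
Hypothesis V_segments : exists S : X -> set X,
  (forall x, V x -> countable (S x)) /\
  (forall x y, V x -> V y -> S x y \/ S y x).

(** Meet, for every [a] in [V], the dense set of conditions containing a point outside [S a]. If
    only countably many points occurred in the filter, their countable segments would cover [V]. *)
Lemma uncountable_kernel : martin_axiom R ->
  (forall (U : Type) (F : set U), F #<= V -> card_lt F [set: R]) -> V x0 ->
  exists f : X -> R, [/\ is_linear f, exists B, bounded_by f B, 1 <= f x0 &
    ~ countable [set y | V y /\ f y = 0]].
Proof.
move=> MA smallV Vx0; have [S [Sc Stot]] := V_segments.
have [y0 [Vy0 /= /eqP yx]] :=
  uncountable_neq0 (uncountableD V_uncountable (countable1 x0)).
pose D a := [set p : P | exists2 y, y \in (\val p).1.2 & ~ S a y].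
have [||G Gfil GD] := MA _ P (forcing_nonempty Vx0 Vy0 yx) forcing_ccc (D @` V).
- exact/smallV/card_image_le.
- by move=> _ [a Va <-]; exact/forcing_dense_avoid/Sc.
pose Z := [set y | exists2 p, G p & y \in (\val p).1.2].
have ZV : Z `<=` V.
  by move=> y [p _ yp]; have [_ _ /(_ y yp)[]] := set_mem (valP p).
have Zunc : ~ countable Z.
  move=> Zc; apply: V_uncountable.
  apply: (@sub_countable _ _ _ (\bigcup_(y in Z) S y)); last first.
    by apply: bigcup_countable => // y /ZV; exact: Sc.
  apply: subset_card_le => a Va.
  have [p [[y yp nSy] Gp]] := GD (D a) (imageP _ Va).
  have Zy : Z y by exists p.
  by exists y => //; have [] := Stot a y Va (ZV _ Zy).
have [f [flin fB f1 f0]] := generic_functional Gfil Zunc.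
exists f; split=> //; apply: contra_not Zunc; apply: sub_countable.
by apply: subset_card_le => y Zy; split; [exact: ZV|exact: f0].
Qed.

End Generic.

(** * Cardinalities, and the contradiction with overcompleteness *)

Lemma uncountable_real (R : realType) : ~ countable [set: R].
Proof.
move=> Rc; have I_countable : countable `[(0 : R), 1]%classic.
  exact: sub_countable (card_leT _) Rc.
have := countable_lebesgue_measure0 I_countable.
rewrite lebesgue_measure_itv /= lte_fin ltr01 oppr0 adde0 => /eqP.
by rewrite eqe oner_eq0.
Qed.

(** If [F] were equipotent to the reals, the reals would embed in [A], hence in every uncountable
    set, which is the continuum hypothesis. *)
Lemma card_omega1_le_lt (R : realType) (T U : Type) (A : set T) (F : set U) :
  ~ continuum_hypothesis R -> card_omega1 A -> F #<= A -> card_lt F [set: R].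
Proof.
move=> notCH [_ A_min] FA; split.
  exact: card_le_trans FA (A_min _ _ (@uncountable_real R)).
apply/negP => FR; apply: notCH; split=> [|W B Bc].
  exact: uncountable_real.
have /andP[_ RF] : (F #<= [set: R]) && ([set: R] #<= F) by rewrite -card_eq_le.
exact: card_le_trans RF (card_le_trans FA (A_min _ _ Bc)).
Qed.

Lemma card_dens_eq (R : realType) (X : normedModType R) (T U : Type)
  (A : set T) (B : set U) : card_dens X A -> card_dens X B -> A #= B.
Proof.
move=> [D [Dd Dmin AD]] [E [Ed Emin BE]].
have DE : D #= E by rewrite card_eq_le Dmin // Emin.
by rewrite (card_eq_trans AD) // (card_eq_trans DE) // card_eq_sym.
Qed.

Lemma vanishing_dense_span (R : realType) (X : normedModType R) (f : X -> R)
    (B : R) (Z : set X) : is_linear f -> bounded_by f B ->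
  (forall z, Z z -> f z = 0) -> dense (lin_span Z) -> forall x, f x = 0.
Proof.
move=> flin fB fZ Zd x.
have f0 : f 0 = 0.
  by apply/eqP; rewrite -normr_le0 (le_trans (fB 0)) // normr0 mulr0.
have span0 y : lin_span Z y -> f y = 0.
  move=> [n [a [z [zZ ->]]]]; elim/big_rec: _ => [//|i y' _ IH].
  by rewrite flin IH fZ // mulr0 addr0.
apply/eqP; rewrite -normr_le0 leNgt; apply/negP => fx.
(* The bound [B] may be zero or negative. *)
have B1 : 0 < `|B| + 1 by rewrite ltr_wpDl.
have e0 : 0 < `|f x| / (`|B| + 1) by rewrite divr_gt0.
have [y [/= xy /span0 fy]] : ball x (`|f x| / (`|B| + 1)) `&` lin_span Z !=set0.
  by apply: Zd; [exists x; exact: ballxx | exact: ball_open].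
have fxy : f x = f (x - y).
  by rewrite addrC -scaleN1r flin fy mulr0 add0r.
move: xy; rewrite -ball_normE /= ltr_pdivlMr // mulrDr mulr1.
have := fB (x - y); rewrite -fxy => H1 H2.
have := ler_wpM2r (normr_ge0 (x - y)) (ler_norm B).
have := normr_ge0 (x - y); rewrite [ `|B| * _]mulrC; lra.
Qed.

Unset Implicit Arguments.

Theorem theorem20 (R : realType) (X : completeNormedModType R)
    (MA : martin_axiom R) (notCH : ~ continuum_hypothesis R)
    (X_infdim : infinite_dimensional X)
    (X_dens : exists2 A : set X, card_omega1 A & card_dens X A)
    (notmono : ~ monolithic R (set_type (dual_unit_ball X))) :
  ~ exists Y : set X, overcomplete Y.
Proof.
move=> [Y [Y_dens Y_over]].
have [A0 [A0_unc A0_min] A0_dens] := X_dens.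
have YA0 := card_dens_eq Y_dens A0_dens.
have omegaY : card_omega1 Y.
  split; first by rewrite (eq_countable YA0).
  by move=> U B Bc; rewrite (card_le_eql YA0); exact: A0_min.
(* By minimality of omega_1, an uncountable subset of [Y] has the cardinality of [Y]. *)
have Y_full (Z : set X) : Z `<=` Y -> ~ countable Z -> dense (lin_span Z).
  move=> ZY Zc; apply: Y_over => //.
  by rewrite card_eq_le subset_card_le //; exact: omegaY.2.
have /existsNP[A /not_implyP[Ac A_nonmetr]] := notmono.
pose A' : set (X -> R) := [set (\val a : X -> R) | a in A].
have A'c : countable A' by apply: sub_countable Ac; exact: card_image_le.
have [g [A'g gA']] := countable_range (fun=> 0) A'c.
have g_good n : is_linear (g n) /\ bounded_by (g n) 1.
  case: (gA' n) => [->|[a _ <-]].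
    by split=> [a x y|x]; rewrite ?mulr0 ?addr0 // normr0 mul1r.
  exact: dual_unit_ball_bounded (set_mem (valP a)).
have g_lin n := (g_good n).1; have g_bnd n := (g_good n).2.
(* If for some [w] no point of [Y] were far from [w], the closure of [A] would be metrizable. *)
have [|m [W [m0 WY Wc Wsep]]] := @uncountable_finitely_separated R X g Y.
  move=> w; apply: contrapT => Yfar; apply: A_nonmetr.
  apply: (@metrizable_closure R X A g w g_bnd _ Y).
  - by move=> a Aa; have [|n _ gn] := A'g (\val a); [exists a|exists n].
  - by apply: Y_full => //; exact: omegaY.1.
  - by move=> y Yy yw; apply: Yfar; exists y.
have [V1 [S [V1W V1c Sc Stot]]] := countable_initial_segments Wc.
have sepS (V : set X) : V `<=` W -> finitely_separated g m V.
  by move=> VW F FV; apply: Wsep => x /FV/VW.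
have [|V [VV1 Vc Vcond]] := condensation_subset g_bnd m0 V1c.
  by move=> y /V1W; exact: finitely_separated_le Wsep.
have VW := subset_trans VV1 V1W; have [x0 Vx0] := uncountable_neq0 Vc.
have [|U F FV|f [f_lin [B fB] fx0 fc]] := uncountable_kernel
  g_lin g_bnd m0 (sepS V VW) Vcond Vc _ MA _ Vx0.
- exists S; split=> [x /VV1|x y /VV1 Vx /VV1]; [exact: Sc|exact: Stot].
- apply: card_omega1_le_lt notCH omegaY _; apply: card_le_trans FV _.
  exact/subset_card_le/(subset_trans VW).
have ZY : [set y | V y /\ f y = 0] `<=` Y by move=> y [/VW/WY].
have f0 z : [set y | V y /\ f y = 0] z -> f z = 0 by case.
(* An uncountable subset of [Y] on which [f] vanishes spans densely, so [f = 0], against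
   [1 <= f x0]. *)
move: fx0; rewrite (vanishing_dense_span f_lin fB f0 (Y_full _ ZY fc)).
by rewrite ler10.
Qed.
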